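(* Let $n\ge 2$ be even and $z\in\tilde I^{\mathsf{FPF}}_n$. Let $\prec$ be the transitive relation on $\tilde S_n$ generated by $u\prec_0 v$, where $u\prec_0 v$ means: there exist $m\in\mathbb Z$ and integers $a<b<c<d$ such that $(u^{-1}(m+1),u^{-1}(m+2),u^{-1}(m+3),u^{-1}(m+4))=(a,d,b,c)$, $(v^{-1}(m+1),v^{-1}(m+2),v^{-1}(m+3),v^{-1}(m+4))=(b,c,a,d)$, and $u^{-1}(k)=v^{-1}(k)$ for all $k\in\{m+5,\dots,m+n\}$ (i.e. $u^{-1}=[\cdots,a,d,b,c,\cdots]$ and $v^{-1}=[\cdots,b,c,a,d,\cdots]$ with the windows otherwise identical). Then $\mathcal A^{\mathsf{FPF}}(z)$ is a bounded poset under $\prec$, with unique minimum $\alpha^{\mathsf{FPF}}_{\min}(z)$ and unique maximum $\alpha^{\mathsf{FPF}}_{\max}(z)$.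
   Context: $\tilde S_n$ is the group of bijections $\pi:\mathbb Z\to\mathbb Z$ with $\pi(i+n)=\pi(i)+n$ and $\sum_{i=1}^n\pi(i)=\sum_{i=1}^n i$, a Coxeter group with generators $s_1,\dots,s_n$ ($s_i$ swaps $i+kn,i+1+kn$ for all $k$) and length $\ell$. $\tilde I^{\mathsf{FPF}}_n$ is the set of $z\in\tilde S_n$ with $z(z(i))=i\ne z(i)$ for all $i$. With $\Theta^+=s_1s_3\cdots s_{n-1}$, $\Theta^-=s_2s_4\cdots s_n$, each $z$ is conjugate to exactly one $\Theta\in\{\Theta^\pm\}$; $\mathcal A^{\mathsf{FPF}}(z)$ is the set of minimal-length $w$ with $w^{-1}\Theta w=z$. Window notation: for integers $c_1,\dots,c_n$ representing each residue mod $n$ once, $[c_1,\dots,c_n]$ is the unique $\pi\in\tilde S_n$ with $\pi(m+k)=c_k$ ($k=1,\dots,n$) for some $m\in\mathbb Z$. With $l=n/2$: $a_1<\dots<a_l$ are the $a\in\{1,\dots,n\}$ with $a<z(a)$, $b_i=z(a_i)$; $d_1<\dots<d_l$ are the $d\in\{1,\dots,n\}$ with $z(d)<d$, $c_i=z(d_i)$; $\alpha^{\mathsf{FPF}}_{\min}(z)=[a_1,b_1,\dots,a_l,b_l]^{-1}$, $\alpha^{\mathsf{FPF}}_{\max}(z)=[c_1,d_1,\dots,c_l,d_l]^{-1}$. *)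

(* Defs.v *)
From HB Require Import structures.
From Stdlib Require Export Relations RelationClasses.
From mathcomp Require Export all_boot all_order all_algebra.
From mathcomp Require Export boolp classical_sets.
From mathcomp Require Import zify ring lra.

Set Implicit Arguments.
Unset Strict Implicit.
Unset Printing Implicit Defensive.

Import Order.TTheory GRing.Theory Num.Theory.
Local Open Scope ring_scope.
Local Open Scope classical_set_scope.

Definition is_affine_perm (n : nat) (f : int -> int) : Prop :=
  [/\ bijective f,
      forall i, f (i + n%:Z) = f i + n%:Z &
      \sum_(1 <= i < n.+1) f i%:Z = \sum_(1 <= i < n.+1) i%:Z].

Record affine_perm (n : nat) := AffinePerm {
  affine_fun :> int -> int;
  affine_permP : is_affine_perm n affine_fun }.

HB.instance Definition _ n := gen_eqMixin (affine_perm n).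
HB.instance Definition _ n := gen_choiceMixin (affine_perm n).

Section Periodic.
Variables (n : nat) (n_gt0 : (0 < n)%N).

Definition equivariant (f : int -> int) := forall i, f (i + n%:Z) = f i + n%:Z.

Let nZ : n%:Z != 0. Proof. by rewrite eqz_nat -lt0n. Qed.

Lemma equivariantM f q i : equivariant f -> f (i + q * n%:Z) = f i + q * n%:Z.
Proof.
move=> ef.
have H (k : nat) j : f (j + k%:Z * n%:Z) = f j + k%:Z * n%:Z.
  elim: k j => [|k IH] j; first by rewrite mul0r !addr0.
  have -> : j + k.+1%:Z * n%:Z = (j + k%:Z * n%:Z) + n%:Z.
    by rewrite -addn1 PoszD; ring.
  by rewrite ef IH -addn1 PoszD; ring.
case: q => k; first exact: H.
have := H k.+1 (i + Negz k * n%:Z); rewrite NegzE.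
have -> : i + - k.+1%:Z * n%:Z + k.+1%:Z * n%:Z = i.
  by rewrite mulNr -addrA addNr addr0.
by move->; rewrite mulNr addrK.
Qed.

Lemma modz_diff (x y : int) :
  (x %% n)%Z = (y %% n)%Z -> exists q, x = y + q * n%:Z.
Proof.
move=> e; exists ((x %/ n)%Z - (y %/ n)%Z); have ex := divz_eq x n; have ey := divz_eq y n.
move: ex ey; rewrite e mulrBl.
by move: (_ %% _)%Z (_ * _) (_ * _) => r a b -> ->; lia. Qed.

Definition res (x : int) : 'I_n.
Proof.
exists (`|(x %% n)%Z|%N); abstract by
  have := ltz_pmod x (n_gt0 : (0 < n%:Z)); have := modz_ge0 x nZ; lia.
Defined.

Lemma resE x : (res x)%:Z = (x %% n)%Z.
Proof. by rewrite /= gez0_abs // modz_ge0. Qed.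

Lemma res_eq x y : res x = res y -> (x %% n)%Z = (y %% n)%Z.
Proof. by move=> e; rewrite -!resE e. Qed.

Lemma res_inj_equi f : equivariant f -> injective f ->
  injective (fun k : 'I_n => res (f (k%:Z + 1) - 1)).
Proof.
move=> ef injf k k' /res_eq /modz_diff [q e].
have {}e : f (k%:Z + 1) = f (k'%:Z + 1 + q * n%:Z).
  by move/(congr1 (+%R^~ 1)): e; rewrite subrK addrAC subrK equivariantM//.
move/injf: e => e; apply/val_inj/eqP; rewrite -eqz_nat; apply/eqP => /=.
have {}e : k%:Z = k'%:Z + q * n%:Z by lia.
have := congr1 (fun x => (x %% n)%Z) e.
by rewrite addrC modzMDl !modz_small //=; have := ltn_ord k; have := ltn_ord k'; lia.
Qed.

Lemma sum_periodic (g f : int -> int) :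
  (forall i, g (i + n%:Z) = g i) -> equivariant f -> injective f ->
  \sum_(1 <= i < n.+1) g (f i%:Z) = \sum_(1 <= i < n.+1) g i%:Z.
Proof.
move=> pg ef injf.
have pgM q i : g (i + q * n%:Z) = g i.
  have /(equivariantM q i) : equivariant (fun i => i + g i).
    by move=> j; rewrite pg; ring.
  lia.
rewrite !big_add1 /= !big_mkord.
rewrite [RHS](reindex_inj (res_inj_equi ef injf)) /=.
apply: eq_bigr => k _; rewrite -(pgM (- ((f (k%:Z + 1) - 1) %/ n)%Z)).
congr g.
have := divz_eq (f (k%:Z + 1) - 1) n.
rewrite !intS gez0_abs ?modz_ge0 // [1 + k%:Z]addrC mulNr.
by move: (f _) (_ %% _)%Z (_ * _) => a b c; lia.
Qed.

Lemma equi_inj_bij f : equivariant f -> injective f -> bijective f.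
Proof.
move=> ef injf.
have [g _ gK] := injF_bij (res_inj_equi ef injf).
have surj y : exists x, f x = y.
  have /res_eq/modz_diff [q] := gK (res (y - 1)); set x := (_ + 1) => e.
  exists (x - q * n%:Z); rewrite -mulNr equivariantM // mulNr.
  by move: e; move: (f x) (_ * _) => a b; lia.
pose h y := xget 0 [set x | f x = y].
have hK : cancel h f by move=> y; rewrite /h; exact: (@xgetPex _ 0 [set x | f x = y] (surj y)).
by exists h => // x; apply: injf; apply: hK.
Qed.

End Periodic.

Section Group.
Variable n : nat.
Implicit Types u v w : affine_perm n.

Lemma affine_perm_ext u v : u =1 v -> u = v.
Proof.
case: u v => [f Pf] [g Pg] /= /funext e.
by move: Pf Pg; rewrite e => Pf Pg; congr AffinePerm; apply: Prop_irrelevance.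
Qed.

Lemma affine_perm_bij w : bijective w. Proof. by case: (affine_permP w). Qed.
Lemma affine_perm_inj w : injective w. Proof. exact/bij_inj/affine_perm_bij. Qed.
Lemma affine_perm_equi w : equivariant n w. Proof. by case: (affine_permP w). Qed.
Lemma affine_perm_sum w :
  \sum_(1 <= i < n.+1) w i%:Z = \sum_(1 <= i < n.+1) i%:Z.
Proof. by case: (affine_permP w). Qed.

Lemma sum_disp u (f : int -> int) : (0 < n)%N -> equivariant n f -> injective f ->
  \sum_(1 <= i < n.+1) u (f i%:Z) = \sum_(1 <= i < n.+1) f i%:Z.
Proof.
move=> n0 ef injf.
have := @sum_periodic n n0 (fun i => u i - i) f _ ef injf.
rewrite !big_split /= !sumrN affine_perm_sum subrr => H.
apply/eqP; rewrite -subr_eq0 H // => i.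
by rewrite affine_perm_equi; ring.
Qed.

Lemma id_affine : is_affine_perm n id.
Proof. by split=> //; exists id. Qed.

Lemma comp_affine u v : is_affine_perm n (u \o v).
Proof.
split=> [|i|]; first by apply: bij_comp; apply: affine_perm_bij.
  by rewrite /= !affine_perm_equi.
have [n0|n0] := posnP n; first by rewrite !big_geq ?n0.
rewrite /= sum_disp ?affine_perm_sum //.
  exact: affine_perm_equi.
exact: affine_perm_inj.
Qed.

Definition inv_fun w (y : int) : int := xget 0 [set x | w x = y].

Lemma inv_funK w : cancel (inv_fun w) w.
Proof.
move=> y; have [g _ wg] := affine_perm_bij w.
exact: (@xgetPex _ 0 [set x | w x = y] (ex_intro _ (g y) (wg y))).
Qed.

Lemma inv_affine w : is_affine_perm n (inv_fun w).
Proof.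
have wK := inv_funK w; have winj := @affine_perm_inj w.
have ei : equivariant n (inv_fun w).
  by move=> i; apply: winj; rewrite affine_perm_equi !wK.
split=> //; first by exists w => // x; apply: winj; rewrite wK.
have [n0|n0] := posnP n; first by rewrite !big_geq ?n0.
rewrite -(@sum_disp w (inv_fun w)) //; first by under eq_bigr do rewrite wK.
exact: can_inj wK.
Qed.

Definition affine_one := AffinePerm id_affine.
Definition affine_mul u v := AffinePerm (comp_affine u v).
Definition affine_inv w := AffinePerm (inv_affine w).

Lemma affine_mulA : associative affine_mul.
Proof. by move=> u v w; apply: affine_perm_ext. Qed.
Lemma affine_mul1 : left_id affine_one affine_mul.
Proof. by move=> u; apply: affine_perm_ext. Qed.
Lemma affine_mulr1 : right_id affine_one affine_mul.
Proof. by move=> u; apply: affine_perm_ext. Qed.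
Lemma affine_mulVr : right_inverse affine_one affine_inv affine_mul.
Proof. by move=> u; apply: affine_perm_ext => x; apply: inv_funK. Qed.
Lemma affine_mulV : left_inverse affine_one affine_inv affine_mul.
Proof.
move=> u; apply: affine_perm_ext => x; apply: (@affine_perm_inj u).
by rewrite /= inv_funK.
Qed.

End Group.

HB.instance Definition _ n := isGroup.Build (affine_perm n)
  (@affine_mulA n) (@affine_mul1 n) (@affine_mulr1 n)
  (@affine_mulV n) (@affine_mulVr n).

Lemma affine_mulE n (u v : affine_perm n) x : (u * v)%g x = u (v x).
Proof. by []. Qed.

Lemma affine_1E n x : (1%g : affine_perm n) x = x.
Proof. by []. Qed.

Definition simple_fun (n : nat) (i x : int) : int :=
  if (x == i %[mod n])%Z then x + 1
  else if (x == i + 1 %[mod n])%Z then x - 1 else x.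

Definition simple (n : nat) (i : int) : affine_perm n :=
  xget 1%g [set s : affine_perm n | s =1 simple_fun n i].

Section Simple.
Variables (n : nat) (n_gt1 : (1 < n)%N).
Let n_gt0 : (0 < n)%N. Proof. exact: ltnW. Qed.

Let eqmS (x i : int) : (x + 1 == i + 1 %[mod n])%Z = (x == i %[mod n])%Z.
Proof. by rewrite eqz_modDr. Qed.

Let eqmn (x i : int) : (x + n%:Z == i %[mod n])%Z = (x == i %[mod n])%Z.
Proof. by rewrite modzDr. Qed.

Lemma eqm_excl (x i : int) : (x == i %[mod n])%Z -> (x == i + 1 %[mod n])%Z = false.
Proof.
move=> /eqP ->; rewrite -{1}[i]addr0.
by rewrite eqz_modDl !modz_small //; lia.
Qed.

Lemma simple_fun_equi i : equivariant n (simple_fun n i).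
Proof. by move=> x; rewrite /simple_fun !eqmn; do 2?case: ifP => _ //; ring. Qed.

Lemma simple_funK i : involutive (simple_fun n i).
Proof.
move=> x; rewrite {2}/simple_fun; case: ifP => [xi|xi].
  rewrite /simple_fun eqmS xi; case: ifP => [h|_]; last by ring.
  by move: (eqm_excl h); rewrite eqmS xi.
case: ifP => [xi1|xi1]; last by rewrite /simple_fun xi xi1.
by rewrite /simple_fun -eqmS subrK xi1.
Qed.

Lemma sum_shift (g : int -> int) : (forall x, g (x + n%:Z) = g x) ->
  \sum_(1 <= x < n.+1) g (x%:Z + 1) = \sum_(1 <= x < n.+1) g x%:Z.
Proof.
move=> pg; apply: (sum_periodic n_gt0 pg (f := fun x => x + 1)); last exact: addIr.
by move=> x; rewrite addrAC.
Qed.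

Lemma simple_affine i : is_affine_perm n (simple_fun n i).
Proof.
split; [exact/inv_bij/simple_funK | exact: simple_fun_equi |].
pose g (x : int) := ((x == i + 1 %[mod n])%Z : nat)%:Z.
have pg x : g (x + n%:Z) = g x by rewrite /g eqmn.
apply/eqP; rewrite -subr_eq0 -sumrB.
rewrite (eq_bigr (fun x : nat => g (x%:Z + 1) - g x%:Z)) => [|x _].
  by rewrite sumrB sum_shift // subrr.
rewrite /g /simple_fun eqmS; case: ifP => [/eqm_excl ->|_] /=; first by ring.
by case: ifP => _ /=; ring.
Qed.

Lemma simpleE i : simple n i =1 simple_fun n i.
Proof. 
have h : exists s : affine_perm n, s =1 simple_fun n i.
  by exists (AffinePerm (simple_affine i)).
exact: (@xgetPex _ 1%g [set s : affine_perm n | s =1 simple_fun n i] h).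
Qed.

End Simple.

Definition window (n : nat) (c : seq int) : affine_perm n :=
  xget 1%g [set w : affine_perm n |
    exists m : int, forall k, (k < n)%N -> w (m + k.+1%:Z) = c`_k].

Section Window.
Variables (n : nat) (n_gt0 : (0 < n)%N).

Lemma window_unique (c : seq int) (u v : affine_perm n) :
  (exists m : int, forall k, (k < n)%N -> u (m + k.+1%:Z) = c`_k) ->
  (exists m : int, forall k, (k < n)%N -> v (m + k.+1%:Z) = c`_k) -> u = v.
Proof.
move=> [m hu] [m' hv].
have huv x : u (m + x) = v (m' + x).
  have e : x = (res n_gt0 (x - 1)).+1%:Z + ((x - 1) %/ n)%Z * n%:Z.
    by rewrite intS resE; have := divz_eq (x - 1) n; lia.
  rewrite e !addrA !(equivariantM _ _ (@affine_perm_equi _ _)).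
  by rewrite hu ?hv.
have sm (w : affine_perm n) (p : int) :
    \sum_(1 <= i < n.+1) w (p + i%:Z) = \sum_(1 <= i < n.+1) i%:Z + p * n%:Z.
  rewrite (@sum_disp n w (fun i => p + i)) //; last exact: addrI.
    rewrite big_split /= big_const_nat subn1 /= iter_addr_0 addrC.
    by rewrite pmulrn mulrzz.
  by move=> i; rewrite addrA.
have : m * n%:Z = m' * n%:Z.
  apply: (addrI (\sum_(1 <= i < n.+1) i%:Z)); rewrite -(sm u) -(sm v).
  by apply: eq_bigr => i _; apply: huv.
move/mulIf => /(_ _) mm'; have {}mm' : m = m' by apply: mm'; lia.
by apply: affine_perm_ext => x; have := huv (x - m); rewrite mm' !subrKC.
Qed.

Lemma windowP (c : seq int) :
  size c = n -> uniq [seq (x %% n)%Z | x <- c] ->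
  exists m : int, forall k, (k < n)%N -> window n c (m + k.+1%:Z) = c`_k.
Proof.
move=> sc uc.
pose f0 (x : int) := c`_(res n_gt0 (x - 1)) + ((x - 1) %/ n)%Z * n%:Z.
have n0 : n%:Z != 0 by lia.
have ef0 : equivariant n f0.
  move=> x; rewrite /f0.
  have -> : x + n%:Z - 1 = (x - 1) + n%:Z by ring.
  have -> : res n_gt0 (x - 1 + n%:Z) = res n_gt0 (x - 1).
    by apply/val_inj; rewrite /= modzDr.
  by rewrite divzDr ?dvdzz // divzz n0 mulrDl mul1r addrA.
have f0E k : (k < n)%N -> f0 k.+1%:Z = c`_k.
  move=> kn; rewrite /f0 (_ : k.+1%:Z - 1 = k%:Z); last lia.
  by rewrite divz_small ?mul0r ?addr0 /= ?modz_small.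
have if0 : injective f0.
  move=> x y e.
  have h : res n_gt0 (x - 1) = res n_gt0 (y - 1).
    have sz (z : 'I_n) : (z < size [seq (x %% n)%Z | x <- c])%N by rewrite size_map sc.
    apply/val_inj/eqP; rewrite -(nth_uniq 0 (sz _) (sz _) uc) !(nth_map 0) ?sc //.
    by move/(congr1 (fun x => (x %% n)%Z)): e; rewrite /f0 ![_ + _ * _]addrC !modzMDl => ->.
  move: e; rewrite /f0 h => /addrI/mulIf -/(_ n0) hq.
  apply: (addIr (-1)); rewrite (divz_eq (x - 1) n) (divz_eq (y - 1) n).
  by rewrite hq -!resE h.
have : (n %| \sum_(1 <= i < n.+1) (f0 i%:Z - i%:Z))%Z.
  have h := @sum_periodic n n_gt0 (fun x => (x %% n)%Z) f0
    (fun x => modzDr x n) ef0 if0.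
  rewrite (eq_bigr (fun i : nat => ((f0 i%:Z %/ n)%Z - (i%:Z %/ n)%Z) * n%:Z
    + ((f0 i%:Z %% n)%Z - (i%:Z %% n)%Z))) => [|i _].
    rewrite big_split /= [X in _ + X]sumrB h subrr addr0 -mulr_suml.
    exact: dvdz_mull.
  by rewrite mulrBl addrACA -opprD -!divz_eq.
case/dvdzP=> m sm.
have Pf : is_affine_perm n (fun x => f0 (x - m)).
  have ef : equivariant n (fun x => f0 (x - m)) by move=> x; rewrite addrAC ef0.
  have jf : injective (fun x => f0 (x - m)) by move=> x y /if0/addIr.
  split=> //; first exact: (equi_inj_bij n_gt0).
  apply/eqP; rewrite -subr_eq0 -sumrB.
  have pg x : f0 (x + n%:Z) - (x + n%:Z) = f0 x - x by rewrite ef0; ring.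
  have es : equivariant n (fun x => x - m) by move=> x; rewrite addrAC.
  have := sum_periodic n_gt0 (g := fun x => f0 x - x) pg es (@addIr _ _).
  rewrite sm => h.
  rewrite (eq_bigr (fun i : nat => f0 (i%:Z - m) - (i%:Z - m) - m)) => [|i _]; last by ring.
  rewrite sumrB h big_const_nat subn1 /= iter_addr_0 pmulrn mulrzz.
  by rewrite subrr.
apply: (@xgetPex _ 1%g [set w : affine_perm n | exists m : int, forall k, (k < n)%N -> w (m + k.+1%:Z) = c`_k]).
by exists (AffinePerm Pf), m => k kn /=; rewrite addrAC subrr add0r f0E.
Qed.

End Window.

(* Products of the generators are compositions of maps, (u * v) x = u (v x);
   a word is the list of the indices of its generators. *)
Definition words (n : nat) (w : affine_perm n) : set (seq nat) :=
  [set r | all (fun i => 0 < i <= n)%N r /\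
           w = (\prod_(i <- r) simple n i%:Z)%g].

Definition coxeter_length (n : nat) (w : affine_perm n) : nat :=
  xget 0%N [set k | (exists2 r, words w r & size r = k) /\
                    forall r, words w r -> (k <= size r)%N].

Section Length.
Variables (n : nat) (n_gt1 : (1 < n)%N).
Let n_gt0 : (0 < n)%N. Proof. exact: ltnW. Qed.
Implicit Type w : affine_perm n.

Let energy w : int := \sum_(1 <= x < n.+1) (w x%:Z - x%:Z) ^+ 2.

Let energy_ge0 w : 0 <= energy w.
Proof. by apply: sumr_ge0 => x _; apply: sqr_ge0. Qed.

Let energy_descent w (i : nat) : (0 < i <= n)%N -> w (i%:Z + 1) < w i%:Z ->
  energy (w * simple n i)%g < energy w.
Proof.
move=> ni di; rewrite -subr_lt0 /energy -sumrB.
pose b (x : int) : int := ((x == i %[mod n])%Z : nat)%:Z.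
have bn x : b (x + n%:Z) = b x by rewrite /b modzDr.
pose g (x : int) := b (x - 1) * ((w (x - 1) - x) ^+ 2 - (w x - x) ^+ 2).
pose d (x : int) := b x * (w (x + 1) - w x).
have pg x : g (x + n%:Z) = g x.
  rewrite /g (_ : x + n%:Z - 1 = x - 1 + n%:Z); last by rewrite addrAC.
  by rewrite bn !affine_perm_equi; congr (_ * (_ ^+ 2 - _ ^+ 2)); ring.
have -> : \sum_(1 <= x < n.+1) (((w * simple n i)%g x%:Z - x%:Z) ^+ 2
     - (w x%:Z - x%:Z) ^+ 2) =
   \sum_(1 <= x < n.+1) (2 * d x%:Z - g (x%:Z + 1)) +
   \sum_(1 <= x < n.+1) g x%:Z.
  rewrite -big_split; apply: eq_bigr => x _ /=.
  rewrite simpleE // /simple_fun /d /g /b addrK.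
  rewrite -[(x%:Z - 1 == _ %[mod n])%Z](eqz_modDr 1) subrK.
  case: ifP => [xi|_]; last by case: ifP => _ /=; ring.
  by rewrite (eqm_excl n_gt1 xi) /=; ring.
rewrite sumrB sum_shift // subrK -mulr_sumr pmulr_rlt0 //.
have dneg (x : nat) : d x%:Z <= 0.
  rewrite /d /b; case: eqP => [/(modz_diff n_gt0) [q ->]|_] /=.
    rewrite addrAC !(equivariantM _ _ (@affine_perm_equi _ _)).
    by rewrite mul1r opprD addrACA subrr addr0 subr_le0 ltW.
  by rewrite mul0r.
rewrite (bigD1_seq i) ?iota_uniq ?mem_index_iota //=.
have di0 : d i%:Z < 0 by rewrite /d /b eqxx mul1r subr_lt0.
by rewrite ltr_wnDr // sumr_le0.
Qed.


Let no_descent w :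
  (forall i : nat, (0 < i <= n)%N -> w i%:Z <= w (i%:Z + 1)) -> w = 1%g.
Proof.
move=> inc.
pose d (x : int) := w x - x.
have dn x : d (x + n%:Z) = d x by rewrite /d affine_perm_equi; ring.
have d1 (i : nat) : (0 < i <= n)%N -> d i%:Z <= d (i%:Z + 1).
  move=> ni; have := inc i ni; rewrite le_eqVlt => /orP[/eqP/affine_perm_inj|]; first lia.
  by rewrite /d; lia.
have up (k : nat) : (k <= n)%N -> d 1 <= d (1 + k%:Z) /\ d (1 + k%:Z) <= d (1 + n%:Z).
  have le_d (j m : nat) : (j + m <= n)%N -> d (1 + j%:Z) <= d (1 + (j + m)%N%:Z).
    elim: m => [|m IH] jm; first by rewrite addn0.
    apply: le_trans (IH _) _; first by lia.
    have := @d1 (j + m).+1; rewrite addnS !intS => h.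
    by rewrite [1 + (1 + _)]addrC; apply: h; lia.
  move=> kn; split; first by have := @le_d 0%N k kn; rewrite addr0 add0n.
  by have := @le_d k (n - k)%N; rewrite subnKC //; apply.
have dc (i : nat) : (0 < i <= n)%N -> d i%:Z = d 1.
  case: i => // i /andP[_ ni]; have [] := up i (ltnW ni).
  by rewrite dn intS => h1 h2; apply/eqP; rewrite eq_le h1 h2.
have d10 : d 1 = 0.
  have : \sum_(1 <= i < n.+1) d i%:Z = 0 by rewrite sumrB affine_perm_sum subrr.
  rewrite (eq_big_nat _ _ (F2 := fun=> d 1)); last by move=> i; apply: dc.
  rewrite big_const_nat subn1 /= iter_addr_0 pmulrn mulrzz => /eqP.
  by rewrite mulf_eq0 => /orP[/eqP //|]; lia.
apply: affine_perm_ext => x; rewrite affine_1E; apply/eqP; rewrite -subr_eq0.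
have dq q y : d (y + q * n%:Z) = d y.
  by rewrite /d (equivariantM _ _ (@affine_perm_equi _ _)); ring.
rewrite -/(d x) -(dq (- ((x - 1) %/ n)%Z)).
have -> : x + - ((x - 1) %/ n)%Z * n%:Z = (res n_gt0 (x - 1)).+1%:Z.
  by rewrite intS resE; have := divz_eq (x - 1) n; lia.
by rewrite dc ?d10 // ltn_ord.
Qed.

Lemma words_ex w : exists r, words w r.
Proof.
have [k] := ubnP `|energy w|%N; elim: k w => // k IH w ew.
have [inc|] := pselect (forall i : nat, (0 < i <= n)%N -> w i%:Z <= w (i%:Z + 1)).
  by exists [::]; split=> //; rewrite big_nil (no_descent inc).
move/existsNP => [i /not_implyP[ni /negP]]; rewrite -ltNge => /(energy_descent ni) lt_e.
have [|r [hr er]] := IH (w * simple n i)%g.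
  by have := energy_ge0 w; have := energy_ge0 (w * simple n i)%g; lia.
exists (rcons r i); split; first by rewrite all_rcons ni.
rewrite -cats1 big_cat big_seq1 /= -er; apply: affine_perm_ext => x.
by rewrite !affine_mulE !simpleE // simple_funK.
Qed.

Lemma coxeter_lengthP w :
  (exists2 r, words w r & size r = coxeter_length w) /\
  forall r, words w r -> (coxeter_length w <= size r)%N.
Proof.
pose P k := `[< exists2 r, words w r & size r = k >].
have exP : exists k, P k.
  by have [r wr] := words_ex w; exists (size r); apply/asboolP; exists r.
apply: (@xgetPex _ 0%N [set k | (exists2 r, words w r & size r = k) /\
  forall r, words w r -> (k <= size r)%N]).
have [k /asboolP Pk mink] := ex_minnP exP.
by exists k; split=> // r wr; apply: mink; apply/asboolP; exists r.
Qed.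

End Length.

Definition fpf_involutions (n : nat) : set (affine_perm n) :=
  [set z | forall i, z (z i) = i /\ z i <> i].
Arguments fpf_involutions n : clear implicits.

Definition Theta_plus (n : nat) : affine_perm n :=
  (\prod_(0 <= j < n./2) simple n (j.*2.+1)%:Z)%g.

Definition Theta_minus (n : nat) : affine_perm n :=
  (\prod_(0 <= j < n./2) simple n (j.*2.+2)%:Z)%g.

(* At most one of the two Theta's is conjugate to z, so Theta is determined by z. *)
Definition fpf_atoms (n : nat) (z : affine_perm n) : set (affine_perm n) :=
  [set w | exists Theta : affine_perm n,
    [/\ Theta = Theta_plus n \/ Theta = Theta_minus n,
        (w^-1 * Theta * w)%g = z &
        forall v : affine_perm n, (v^-1 * Theta * v)%g = z ->
          (coxeter_length w <= coxeter_length v)%N]].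

Definition ascents (n : nat) (z : affine_perm n) : seq int :=
  [seq a <- [seq i%:Z | i <- iota 1 n] | a < z a].

Definition descents (n : nat) (z : affine_perm n) : seq int :=
  [seq d <- [seq i%:Z | i <- iota 1 n] | z d < d].

Definition alpha_min (n : nat) (z : affine_perm n) : affine_perm n :=
  (window n (flatten [seq [:: a; z a] | a <- ascents z]))^-1%g.

Definition alpha_max (n : nat) (z : affine_perm n) : affine_perm n :=
  (window n (flatten [seq [:: z d; d] | d <- descents z]))^-1%g.

Definition prec0 (n : nat) (u v : affine_perm n) : Prop :=
  exists m a b c d : int,
    [/\ [/\ a < b, b < c & c < d],
        [/\ u^-1%g (m + 1) = a, u^-1%g (m + 2) = d,
            u^-1%g (m + 3) = b & u^-1%g (m + 4) = c],
        [/\ v^-1%g (m + 1) = b, v^-1%g (m + 2) = c,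
            v^-1%g (m + 3) = a & v^-1%g (m + 4) = d] &
        forall k : int, m + 5 <= k <= m + n%:Z -> u^-1%g k = v^-1%g k].

Definition prec (n : nat) : relation (affine_perm n) :=
  clos_trans (affine_perm n) (@prec0 n).
Arguments prec n : clear implicits.

Section StrictPoset.
Variables (T : Type) (A : set T) (R : relation T).

Definition restrict_rel : relation {x : T | A x} :=
  fun x y => R (proj1_sig x) (proj1_sig y).

Definition minimum_elements : set T :=
  [set x | A x /\ forall y, A y -> x = y \/ R x y].

Definition maximum_elements : set T :=
  [set x | A x /\ forall y, A y -> y = x \/ R y x].

End StrictPoset.

Arguments restrict_rel {T} A R.
Arguments minimum_elements {T} A R.
Arguments maximum_elements {T} A R.

(* Main.v *)
Require Import Defs.
From mathcomp Require Import zify ring.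
Import Order.TTheory GRing.Theory Num.Theory.
Local Open Scope ring_scope.
Local Open Scope classical_set_scope.

Set Implicit Arguments.
Unset Strict Implicit.
Unset Printing Implicit Defensive.

(* Write u = w^-1. Then w^-1 Theta w = z says that u lists the cycles of z as
   consecutive blocks of two positions. By the exchange property, minimality of
   the length of w forces every block to be increasing, and forces two adjacent
   blocks (p, q), (r, s) to satisfy p < r and q < s unless one of the cycles is
   nested in the other. Swapping two adjacent nested blocks preserves
   minimality, and is exactly a step of the order. Hence a minimal w whose
   blocks are not sorted by their smaller (larger) elements admits a step down
   (up); the energy sum_k (key (u k) - k)^2, where key sends an integer to the
   smaller (larger) element of its cycle, drops at each such step, so sorting
   terminates, at the unique w with sorted blocks, alpha_min (alpha_max). The
   same energy for the smaller elements increases along the order, which is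
   therefore irreflexive. *)

(** * The exchange property and the change of length under a generator *)

Section Length.
Variables (n : nat) (n_gt1 : (1 < n)%N).
Implicit Types (u v w : affine_perm n) (c i q r x y : int).

Lemma affine_permMn w x q : w (x + q * n%:Z) = w x + q * n%:Z.
Proof. exact/equivariantM/affine_perm_equi. Qed.

Lemma affine_permK w x : w^-1%g (w x) = x.
Proof. by rewrite -affine_mulE mulVg. Qed.

Lemma affine_permKV w x : w (w^-1%g x) = x.
Proof. by rewrite -affine_mulE mulgV. Qed.

Lemma residue_decomp c x :
  exists r q, [/\ 0 <= r, r < n%:Z & x = c + r + q * n%:Z].
Proof.
have n0 : 0 < n%:Z by lia.
exists ((x - c) %% n)%Z, ((x - c) %/ n)%Z; split.
- by rewrite modz_ge0 //; lia.
- exact: ltz_pmod.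
- by have := divz_eq (x - c) n; lia.
Qed.

Definition adjacent_transp (a r : int) : int :=
  if r == a then a + 1 else if r == a + 1 then a else r.

Lemma adjacent_transpP (a r : int) (r' := adjacent_transp a r) :
  r = a /\ r' = a + 1 \/ r = a + 1 /\ r' = a \/ r <> a /\ r <> a + 1 /\ r' = r.
Proof.
rewrite /r' /adjacent_transp; case: eqP => [->|?]; first by left.
by right; case: eqP => [->|?]; [left | right].
Qed.

(** The base point [c] is chosen by each caller so that [c + a] and [c + a + 1] lie in the same
    window; the generator then acts on the offset [r] alone, and congruences become comparisons of
    offsets. *)
Lemma simple_local c a r q : 0 <= a -> a + 1 < n%:Z -> 0 <= r < n%:Z ->
  simple n (c + a) (c + r + q * n%:Z) = c + adjacent_transp a r + q * n%:Z.
Proof.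
move=> a0 an rn; rewrite simpleE // /simple_fun.
have E b : 0 <= b < n%:Z -> (c + r + q * n%:Z == c + b %[mod n])%Z = (r == b).
  move=> bn; rewrite -addrA eqz_modDl addrC modzMDl.
  by rewrite !modz_small.
rewrite -(addrA c a 1) !E; [|lia|lia].
rewrite /adjacent_transp; case: eqP => [->|_]; first by ring.
by case: eqP => [->|_]; ring.
Qed.

Lemma simple_periodic i q : simple n (i + q * n%:Z) = simple n i.
Proof.
apply: affine_perm_ext => x.
rewrite !simpleE // /simple_fun.
by rewrite (addrAC i) -!(addrC (q * _)) !modzMDl.
Qed.

Lemma simpleK i : involutive (simple n i).
Proof. by move=> x; rewrite !simpleE // simple_funK. Qed.

Lemma simple_mulg i : (simple n i * simple n i = 1)%g.
Proof. by apply: affine_perm_ext => x; rewrite affine_mulE simpleK. Qed.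

Lemma simple_invg i : ((simple n i)^-1 = simple n i)%g.
Proof. by apply: (mulgI (simple n i)); rewrite mulgV simple_mulg. Qed.

Variant simple_spec i x : int -> Prop :=
| SimpleUp q of x = i + q * n%:Z : simple_spec i x (x + 1)
| SimpleDown q of x = i + 1 + q * n%:Z : simple_spec i x (x - 1)
| SimpleFix of (forall q, x <> i + q * n%:Z)
    & (forall q, x <> i + 1 + q * n%:Z) : simple_spec i x x.

Lemma simpleP i x : simple_spec i x (simple n i x).
Proof.
have H y q : (y + q * n%:Z == y %[mod n])%Z by rewrite addrC modzMDl.
rewrite simpleE // /simple_fun; case: ifPn => [/eqP/modz_diff|h1].
  by case; [lia | move=> q xq; apply: (SimpleUp (q := q))].
case: ifPn => [/eqP/modz_diff|h2].
  by case; [lia | move=> q xq; apply: (SimpleDown (q := q))].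
by apply: SimpleFix => q xq; move: h1 h2; rewrite xq H.
Qed.

Lemma simple_up i q : simple n i (i + q * n%:Z) = i + 1 + q * n%:Z.
Proof.
have := @simple_local i 0 0 q; rewrite !addr0 /adjacent_transp eqxx add0r.
by apply; lia.
Qed.

Lemma simple_down i q : simple n i (i + 1 + q * n%:Z) = i + q * n%:Z.
Proof. by rewrite -(simple_up i) simpleK. Qed.

Definition word_prod (s : seq nat) : affine_perm n := (\prod_(j <- s) simple n j%:Z)%g.

Lemma word_prod_rcons s j : word_prod (rcons s j) = (word_prod s * simple n j%:Z)%g.
Proof. by rewrite /word_prod -cats1 big_cat big_seq1. Qed.

(** Induction from the right end of the word. Let [w] be the product without the last letter [j]. If
    [w] already has the descent, a letter can be removed from its word; otherwise the last letter
    creates the descent, which forces [s_i w = w s_j], and that letter cancels. *)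
Lemma exchange (s : seq nat) i :
  all (fun j => 0 < j <= n)%N s ->
  (word_prod s)^-1%g (i + 1) < (word_prod s)^-1%g i ->
  exists2 s', words (simple n i * word_prod s)%g s' & (size s' < size s)%N.
Proof.
elim/last_ind: s => [|s j IH].
  by rewrite /word_prod big_nil invg1 !affine_1E; lia.
rewrite all_rcons word_prod_rcons; set w := word_prod s in IH *.
move=> /andP[jn sn]; rewrite invgM simple_invg !affine_mulE => desc.
have [/(IH sn)[s' [s'n es'] lt_s']|asc] := ltP (w^-1%g (i + 1)) (w^-1%g i).
  exists (rcons s' j); last by rewrite !size_rcons.
  split; first by rewrite all_rcons jn.
  by rewrite -/(word_prod _) word_prod_rcons /word_prod -es' mulgA.
exists s; last by rewrite size_rcons.
split=> //; rewrite -/(word_prod s) -/w.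
have [y ey]: exists y, w^-1%g i = y by eexists.
have [y' ey']: exists y', w^-1%g (i + 1) = y' by eexists.
have neq : y != y'.
  by rewrite -ey -ey'; apply/eqP => /affine_perm_inj; lia.
rewrite ey ey' in desc asc.
(* A generator reverses the order only of two values that it exchanges, so [y] and [y'] are
   consecutive and [y] is congruent to [j]. *)
have [/= q yq y'E] : exists2 q, y = j%:Z + q * n%:Z & y' = y + 1.
  move: desc.
  case: (simpleP j%:Z y) => [q eq|q eq|f1 f2]; case: (simpleP j%:Z y') => [q' eq'|q' eq'|f1' f2'] lt;
    try (by exists q; lia); lia.
have wy : w y = i by rewrite -ey affine_permKV.
have wy' : w (y + 1) = i + 1 by rewrite -y'E -ey' affine_permKV.
have sjE : simple n j%:Z = simple n y by rewrite yq simple_periodic.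
rewrite sjE; apply: affine_perm_ext => x; rewrite !affine_mulE.
apply: (can_inj (simpleK i)); rewrite simpleK.
case: (simpleP y x) => [p ->|p ->|f1 f2].
- by rewrite addrAC !(affine_permMn w) wy wy' simple_up.
- by rewrite addrAC addrK !(affine_permMn w) wy wy' simple_down.
- case: (simpleP i (w x)) => // p.
    by rewrite -wy -affine_permMn => /affine_perm_inj/f1.
  by rewrite -wy' -affine_permMn => /affine_perm_inj/f2.
Qed.

Lemma length_words w s : words w s -> (coxeter_length w <= size s)%N.
Proof. by case: (coxeter_lengthP n_gt1 w) => _; apply. Qed.

Lemma length_descent w i : w^-1%g (i + 1) < w^-1%g i ->
  (coxeter_length (simple n i * w)%g < coxeter_length w)%N.
Proof.
have [[s [sn ws] <-] _] := coxeter_lengthP n_gt1 w.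
rewrite ws => /(exchange sn)[s' /length_words le_s' lt_s'].
exact: leq_ltn_trans lt_s'.
Qed.

Lemma length_simple_mul w i :
  (coxeter_length (simple n i * w)%g <= (coxeter_length w).+1)%N.
Proof.
have [[s [sn ws] <-] _] := coxeter_lengthP n_gt1 w.
(* Letters of words lie in [1..n], so [i] is replaced by its representative [1 + r] there. *)
have [r [q [r0 rn iE]]] := residue_decomp 1 i.
suff : words (simple n i * w)%g (`|(1 + r)%R|%N :: s) by move/length_words.
split; first by rewrite /= sn andbT; lia.
by rewrite big_cons ws iE simple_periodic; congr (simple n _ * _)%g; lia.
Qed.

Lemma length_simple_bound w i :
  (coxeter_length (simple n i * w)%g)%:Z <= (coxeter_length w)%:Z
    + (if w^-1%g (i + 1) < w^-1%g i then -1 else 1).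
Proof.
by case: ifP => [/length_descent|_]; [|have := length_simple_mul w i]; lia.
Qed.

End Length.

(** * Exchanging two adjacent blocks: effect on length and energy *)

Section BlockSwap.
Variables (n : nat) (n_gt3 : (3 < n)%N).
Let n_gt1 : (1 < n)%N. Proof. exact: ltn_trans n_gt3. Qed.
Implicit Types (u v w : affine_perm n) (c q r t x : int).

(** This exchanges positions [c, c + 1] with [c + 2, c + 3] in every period. It is given as a word
    of four generators so that the change of length can be counted letter by letter. *)
Definition block_swap c : affine_perm n :=
  (simple n (c + 1) * simple n c * simple n (c + 2) * simple n (c + 1))%g.

Lemma block_swapE c r q : 0 <= r < n%:Z ->
  block_swap c (c + r + q * n%:Z) =
  c + (if r < 2 then r + 2 else if r < 4 then r - 2 else r) + q * n%:Z.
Proof.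
move=> rn; rewrite !affine_mulE -{2}[c]addr0.
have tP a y := adjacent_transpP a y.
rewrite !simple_local; try lia.
all: have := tP 1 r; set r1 := adjacent_transp 1 r => P1; try lia.
all: have := tP 2 r1; set r2 := adjacent_transp 2 r1 => P2; try lia.
all: have := tP 0 r2; set r3 := adjacent_transp 0 r2 => P3; try lia.
by have := tP 1 r3; do ?[case: ifP => ?]; lia.
Qed.

Lemma block_swap_near c (r : int) : 0 <= r < n%:Z ->
  block_swap c (c + r) = c + (if r < 2 then r + 2 else if r < 4 then r - 2 else r).
Proof. by move=> rn; have := block_swapE c 0 rn; rewrite mul0r !addr0. Qed.

Local Notation inversion_sign b := (if b then -1 else 1 : int).

(** Each of the four generators exchanges one entry of the first block with one of the second, so
    each of the four cross pairs is compared exactly once. *)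
Lemma length_block_swap w c :
  (coxeter_length ((block_swap c)^-1 * w)%g)%:Z <= (coxeter_length w)%:Z
    + inversion_sign (w^-1%g (c + 2) < w^-1%g (c + 1))
    + inversion_sign (w^-1%g (c + 2) < w^-1%g c)
    + inversion_sign (w^-1%g (c + 3) < w^-1%g (c + 1))
    + inversion_sign (w^-1%g (c + 3) < w^-1%g c).
Proof.
rewrite /block_swap !invgM !simple_invg // -!mulgA.
have near a r : 0 <= a < 3 -> 0 <= r < 4 ->
    simple n (c + a) (c + r) = c + adjacent_transp a r.
  by move=> a3 r4; have := @simple_local n n_gt1 c a r 0; rewrite mul0r !addr0; apply; lia.
have [s00 s01 s02 s03] : [/\ simple n c c = c + 1, simple n c (c + 1) = c,
    simple n c (c + 2) = c + 2 & simple n c (c + 3) = c + 3].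
  by split; [have := near 0 0|have := near 0 1|have := near 0 2|have := near 0 3];
    rewrite !addr0 /adjacent_transp => ->.
have [s10 s11 s12 s13] : [/\ simple n (c + 1) c = c, simple n (c + 1) (c + 1) = c + 2,
    simple n (c + 1) (c + 2) = c + 1 & simple n (c + 1) (c + 3) = c + 3].
  by split; [have := near 1 0|have := near 1 1|have := near 1 2|have := near 1 3];
    rewrite ?addr0 /adjacent_transp => ->.
have s22 : simple n (c + 2) (c + 2) = c + 3 by rewrite near.
have s21 : simple n (c + 2) (c + 1) = c + 1 by rewrite near.
set w1 := (simple n (c + 1) * w)%g; set w2 := (simple n c * w1)%g.
set w3 := (simple n (c + 2) * w2)%g.
have := length_simple_bound n_gt1 w (c + 1).
have := length_simple_bound n_gt1 w1 c.
have := length_simple_bound n_gt1 w2 (c + 2).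
have := length_simple_bound n_gt1 w3 (c + 1).
rewrite /w3 /w2 /w1 !invgM !simple_invg // !affine_mulE -!(addrA c).
rewrite s22 s21 s03 s13 s01 s10 s02 s12 s11.
rewrite (_ : 1 + 1 = 2) // => le4 le3 le2 le1.
apply: le_trans le4 _; rewrite lerD2r; apply: le_trans le3 _; rewrite lerD2r.
by apply: le_trans le2 _; rewrite lerD2r.
Qed.

Lemma block_swap_fix c k : c + 4 <= k < c + n%:Z -> block_swap c k = k.
Proof.
by move=> kc; rewrite -{1}(subrKC c k) block_swap_near; do ?case: ifP => ?; lia.
Qed.

Lemma block_swapV c x : (block_swap c)^-1%g x = block_swap c x.
Proof.
apply: (@affine_perm_inj _ (block_swap c)); rewrite affine_permKV.
have [r [q [r0 rn ->]]] := residue_decomp n_gt1 c x.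
rewrite block_swapE; last by lia.
by do ?case: ifP => ?; rewrite block_swapE; do ?case: ifP => ?; lia.
Qed.

Definition energy (h u : int -> int) : int := \sum_(1 <= k < n.+1) (h (u k%:Z) - k%:Z) ^+ 2.

(* Both blocks of two keys move by two positions, so only the cross terms
   [-2 k (h (u k))] of the energy change. *)
Lemma energy_block_swap (h : int -> int) u c : equivariant n h ->
  h (u (c + 1)) = h (u c) -> h (u (c + 3)) = h (u (c + 2)) ->
  energy h (u * block_swap c)%g = energy h u + 8 * (h (u (c + 2)) - h (u c)).
Proof.
move=> eh h01 h23.
(* The summand is [n]-periodic, so the sum may start at [c]; the four moved positions then come
   first. *)
have E v : energy h v = \sum_(0 <= k < n) (h (v (c + k%:Z)) - (c + k%:Z)) ^+ 2.
  pose g k := (h (v k) - k) ^+ 2; pose f k := k + (c - 1).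
  have pg k : g (k + n%:Z) = g k.
    by rewrite /g affine_perm_equi eh; congr (_ ^+ 2); ring.
  have ef : equivariant n f by move=> k; rewrite /f; ring.
  rewrite -[LHS](sum_periodic (ltnW n_gt1) pg ef (@addIr _ _)) big_add1.
  by apply: eq_bigr => k _; rewrite /g (_ : f k.+1%:Z = c + k%:Z) // /f; lia.
rewrite !E; do 4 (rewrite [in LHS]big_ltn; last lia); do 4 (rewrite [in RHS]big_ltn; last lia).
rewrite [X in _ + (_ + (_ + (_ + X))) = _](eq_big_nat _ _ (F2 := fun k => (h (u (c + k%:Z)) - (c + k%:Z)) ^+ 2)).
  move: (\sum_(4 <= k < n) _) => S; rewrite !(affine_mulE u) !block_swap_near; try lia.
  (* Each key occurs at two positions, each shifted by two, and the cross term has coefficient 2: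
     hence the factor 8. *)
  rewrite /= addr0 !add0r h01 h23; ring.
by move=> k kn; rewrite (affine_mulE u) block_swap_fix //; lia.
Qed.

End BlockSwap.

(** * Conjugates of the two base involutions as pairings of consecutive positions *)

Lemma parity_cases (e x : int) : exists t, x = e + 1 + 2 * t \/ x = e + 2 + 2 * t.
Proof.
have := divz_eq (x - e - 1) 2; have := @modz_ge0 (x - e - 1) 2 isT.
have := ltz_pmod (x - e - 1) (isT : 0 < 2 :> int).
by move: (_ %% _)%Z (_ %/ _)%Z => r q *; exists q; lia.
Qed.

Section Theta.
Variables (n : nat) (n_ge2 : (1 < n)%N) (n_even : ~~ odd n).
Implicit Types (u v w z : affine_perm n) (e c q r t x : int).

Lemma prod_fix (I : eqType) (s : seq I) (F : I -> affine_perm n) x :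
  (forall j, j \in s -> F j x = x) -> (\prod_(j <- s) F j)%g x = x.
Proof.
elim: s => [|j s IH] fx; first by rewrite big_nil affine_1E.
rewrite big_cons affine_mulE IH => [|i si]; first by rewrite fx ?mem_head.
by rewrite fx // inE si orbT.
Qed.

(** The factors on either side of [F i] fix both [x] and [y], so the place of [F i] in the product
    does not matter. *)
Lemma prod_move (I : eqType) (s : seq I) (F : I -> affine_perm n) x y i :
  uniq s -> i \in s -> F i x = y ->
  (forall j, j \in s -> j != i -> F j x = x /\ F j y = y) ->
  (\prod_(j <- s) F j)%g x = y.
Proof.
elim: s => // j s IH /= /andP[js us] si Fi Fj; rewrite big_cons affine_mulE.
have [eij|ji] := eqVneq j i.
  rewrite prod_fix ?eij // => k ks; apply: (proj1 (Fj k _ _)).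
    by rewrite inE ks orbT.
  by apply: contraNneq js; rewrite eij => <-.
rewrite IH //; first by apply: (proj2 (Fj j _ _)); rewrite ?mem_head.
  by move: si; rewrite inE eq_sym (negPf ji).
by move=> k ks; apply: Fj; rewrite inE ks orbT.
Qed.

Definition theta (e : nat) : affine_perm n :=
  (\prod_(0 <= j < n./2) simple n (j.*2.+1 + e)%N%:Z)%g.

Lemma theta_plus : Theta_plus n = theta 0.
Proof. by apply: eq_bigr => j _; rewrite addn0. Qed.

Lemma theta_minus : Theta_minus n = theta 1.
Proof. by apply: eq_bigr => j _; rewrite addn1. Qed.

Lemma thetaE (e : nat) t :
  theta e (e%:Z + 1 + 2 * t) = e%:Z + 2 + 2 * t /\
  theta e (e%:Z + 2 + 2 * t) = e%:Z + 1 + 2 * t.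
Proof.
have nE : n = (n./2).*2 by have := odd_double_half n; rewrite (negPf n_even).
have l0 : (0 < n./2)%N by lia.
have lZ : (n./2)%:Z != 0 by lia.
(* With [t = j + q * (n/2)], block [t] is the translate by [q] periods of the block that the [j]-th
   generator exchanges. *)
have := divz_eq t (n./2)%:Z; have := modz_ge0 t lZ; have := ltz_pmod t (l0 : 0 < (n./2)%:Z).
move: (_ %% _)%Z (_ %/ _)%Z => r q; case: r => // j jl _ tE.
have qn : 2 * (q * (n./2)%:Z) = q * n%:Z.
  by rewrite {2}nE -mul2n PoszM; ring.
have S (i b : nat) : (i < n./2)%N -> (b < 2)%N ->
    simple n (i.*2.+1 + e)%N%:Z (e%:Z + 1 + (j.*2 + b)%N%:Z + q * n%:Z) =
    e%:Z + 1 + (if i == j then j.*2 + (b == 0)%N else j.*2 + b)%N%:Z + q * n%:Z.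
  move=> il b2; rewrite (_ : (_ + e)%N%:Z = e%:Z + 1 + i.*2%:Z); last by lia.
  rewrite simple_local; try lia.
  by have := adjacent_transpP i.*2%:Z (j.*2 + b)%N%:Z; case: eqVneq => ij; lia.
have x1 : e%:Z + 1 + 2 * t = e%:Z + 1 + (j.*2 + 0)%N%:Z + q * n%:Z.
  by rewrite tE mulrDr qn; lia.
have x2 : e%:Z + 2 + 2 * t = e%:Z + 1 + (j.*2 + 1)%N%:Z + q * n%:Z.
  by rewrite tE mulrDr qn; lia.
rewrite x1 x2; split; (apply: (@prod_move _ _ _ _ _ j);
  [exact: iota_uniq | by rewrite mem_index_iota; lia | by rewrite S ?eqxx //; lia |]);
  by move=> i; rewrite mem_index_iota => il /negPf ij; rewrite !S ?ij //; lia.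
Qed.

Definition paired z e u := forall t, z (u (e + 1 + 2 * t)) = u (e + 2 + 2 * t).

Lemma conj_theta z (e : nat) w : involutive z ->
  (w^-1 * theta e * w)%g = z <-> paired z e w^-1%g.
Proof.
move=> zK; split=> [<- t|zP].
  by rewrite !affine_mulE affine_permKV (proj1 (thetaE e t)).
apply: affine_perm_ext => x; rewrite -{2}(affine_permK w x) !affine_mulE.
have [t [->|->]] := parity_cases e (w x).
  by rewrite (proj1 (thetaE e t)) zP.
by rewrite (proj2 (thetaE e t)) -zP zK.
Qed.

Lemma paired_simple z e u t : involutive z -> paired z e u ->
  paired z e (u * simple n (e + 1 + 2 * t))%g.
Proof.
move=> zK zu t'; rewrite !affine_mulE; set c := e + 1 + 2 * t.
have [r [q [r0 rn xE]]] := residue_decomp n_ge2 c (e + 1 + 2 * t').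
have nE : n = (n./2).*2 by have := odd_double_half n; rewrite (negPf n_even).
have qn : q * n%:Z = 2 * (q * (n./2)%:Z).
  by rewrite {1}nE -mul2n PoszM; ring.
have yE : e + 2 + 2 * t' = c + (r + 1) + q * n%:Z by lia.
rewrite xE yE -{1 3}[c]addr0 !simple_local; try lia.
have := adjacent_transpP 0 r; have := adjacent_transpP 0 (r + 1).
set a := adjacent_transp 0 r; set b := adjacent_transp 0 (r + 1) => bP aP.
(* As [n] is even, so is [r]: either this is the block being reversed, or the block lies wholly
   outside it. *)
have [r0' | r2] : r = 0 \/ 2 <= r by lia.
  have -> : c + a + q * n%:Z = e + 2 + 2 * t' by lia.
  have -> : c + b + q * n%:Z = e + 1 + 2 * t' by lia.
  by rewrite -zu zK.
have -> : c + a + q * n%:Z = e + 1 + 2 * t' by lia.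
by have -> : c + b + q * n%:Z = e + 2 + 2 * t' by lia.
Qed.

End Theta.

Section PairedBlockSwap.
Variables (n : nat) (n_gt3 : (3 < n)%N) (n_even : ~~ odd n).
Implicit Types (u v w z : affine_perm n) (e t : int).

Lemma paired_block_swap z e u t : paired z e u ->
  paired z e (u * block_swap n (e + 1 + 2 * t))%g.
Proof.
move=> zu t'; rewrite !(affine_mulE u); set c := e + 1 + 2 * t.
have [r [q [r0 rn xE]]] := residue_decomp (ltnW (ltnW n_gt3)) c (e + 1 + 2 * t').
have nE : n = (n./2).*2 by have := odd_double_half n; rewrite (negPf n_even).
have qn : q * n%:Z = 2 * (q * (n./2)%:Z).
  by rewrite {1}nE -mul2n PoszM; ring.
have yE : e + 2 + 2 * t' = c + (r + 1) + q * n%:Z by lia.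
rewrite xE yE !block_swapE; try lia.
(* Again [r] is even, so whole blocks move to whole blocks. *)
have [s [-> ->]] : exists s,
    c + (if r < 2 then r + 2 else if r < 4 then r - 2 else r) + q * n%:Z = e + 1 + 2 * s /\
    c + (if r + 1 < 2 then r + 1 + 2 else if r + 1 < 4 then r + 1 - 2 else r + 1)
      + q * n%:Z = e + 2 + 2 * s.
  exists (if r < 2 then t' + 1 else if r < 4 then t' - 1 else t').
  by split; do ?case: ifP => ?; lia.
exact: zu.
Qed.

End PairedBlockSwap.

(** * Minimal elements for a fixed offset: increasing blocks, nested neighbours, sorting *)

Section MinimalPaired.
Variables (n : nat) (n_ge2 : (1 < n)%N) (n_even : ~~ odd n).
Variables (z : affine_perm n) (zK : involutive z).
Implicit Types (u v w : affine_perm n) (e t : int).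

Definition minimal_paired e w :=
  paired z e w^-1%g /\
  forall v, paired z e v^-1%g -> (coxeter_length w <= coxeter_length v)%N.

Lemma fpf_atomsP w :
  fpf_atoms z w <-> exists2 e : nat, (e < 2)%N & minimal_paired e%:Z w.
Proof.
split=> [[Th [ThE zw wmin]]|[e e2 [zw wmin]]].
  have [e e2 {}ThE] : exists2 e : nat, (e < 2)%N & Th = theta n e.
    by case: ThE => ->; [exists 0%N; rewrite ?theta_plus|exists 1%N; rewrite ?theta_minus].
  rewrite {}ThE in zw wmin.
  exists e => //; split; first exact/(conj_theta n_ge2 n_even e w zK).
  by move=> v /(conj_theta n_ge2 n_even e v zK); apply: wmin.
exists (theta n e); split.
- by case: e e2 {zw wmin} => [|[|//]] _; [left; rewrite theta_plus|right; rewrite theta_minus].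
- exact/(conj_theta n_ge2 n_even e w zK).
- by move=> v /(conj_theta n_ge2 n_even e v zK); apply: wmin.
Qed.

Lemma minimal_paired_ex e w : paired z e w^-1%g -> exists v, minimal_paired e v.
Proof.
move=> zw.
pose P k := `[< exists2 v, paired z e v^-1%g & coxeter_length v = k >].
have exP : exists k, P k by exists (coxeter_length w); apply/asboolP; exists w.
have [k /asboolP[v zv <-] vmin] := ex_minnP exP.
by exists v; split=> // v' zv'; apply: vmin; apply/asboolP; exists v'.
Qed.

(** Reversing a decreasing block would keep the pairing, by [paired_simple], and shorten [w]. *)
Lemma minimal_paired_ascent e w t : minimal_paired e w ->
  w^-1%g (e + 1 + 2 * t) < w^-1%g (e + 2 + 2 * t).
Proof.
case=> zw wmin; have [//|] := ltP; rewrite le_eqVlt => /orP[/eqP/affine_perm_inj|desc].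
  by lia.
have /(length_descent n_ge2) : w^-1%g (e + 1 + 2 * t + 1) < w^-1%g (e + 1 + 2 * t).
  by rewrite (_ : _ + 1 = e + 2 + 2 * t) //; lia.
rewrite ltnNge wmin // invgM simple_invg //.
exact: paired_simple.
Qed.

(* For [b = false] (resp. [b = true]) the key of a cycle of [z] is its smaller
   (resp. larger) element; in the inverse of a minimal element it sits at the
   first (resp. second) position of its block. *)
Definition key (b : bool) x : int := if b then Num.max x (z x) else Num.min x (z x).

Lemma key_equivariant b : equivariant n (key b).
Proof.
by move=> x; rewrite /key affine_perm_equi; case: b; rewrite ?addr_maxl ?addr_minl.
Qed.

Lemma key_paired (b : bool) e w t : minimal_paired e w ->
  key b (w^-1%g (e + 1 + 2 * t)) = w^-1%g (e + 1 + b%:Z + 2 * t) /\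
  key b (w^-1%g (e + 2 + 2 * t)) = w^-1%g (e + 1 + b%:Z + 2 * t).
Proof.
move=> mw; have zw := (proj1 mw) t; have asc := minimal_paired_ascent t mw.
have zw' : z (w^-1%g (e + 2 + 2 * t)) = w^-1%g (e + 1 + 2 * t) by rewrite -zw zK.
rewrite /key zw' zw; case: b => /=.
  have -> : e + 1 + 1%:Z + 2 * t = e + 2 + 2 * t by lia.
  by rewrite (max_r (ltW asc)) (max_l (ltW asc)).
by rewrite addr0 (min_l (ltW asc)) (min_r (ltW asc)).
Qed.

Section Nested.
Hypothesis n_gt3 : (3 < n)%N.
Variables (e t : int) (w : affine_perm n).
Let c := e + 1 + 2 * t.
Let u := w^-1%g.
Hypothesis mw : minimal_paired e w.

Let asc0 : u c < u (c + 1).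
Proof. by rewrite (_ : c + 1 = e + 2 + 2 * t); [exact: minimal_paired_ascent|lia]. Qed.

Let asc2 : u (c + 2) < u (c + 3).
Proof.
have := minimal_paired_ascent (t + 1) mw.
have -> : e + 1 + 2 * (t + 1) = c + 2 by rewrite /c; ring.
by have -> : e + 2 + 2 * (t + 1) = c + 3 by rewrite /c; ring.
Qed.

Let paired_swap : paired z e ((block_swap n c)^-1 * w)^-1%g.
Proof. by rewrite invgM invgK; apply: paired_block_swap => //; case: mw. Qed.

(** If both the smaller and the larger elements of the two blocks were out of order, at least three
    of the four cross pairs would be inversions, and the swap would shorten [w] by at least two. *)
Lemma minimal_paired_nested (b : bool) : u (c + b%:Z + 2) < u (c + b%:Z) ->
  u (c + (~~ b)%:Z) < u (c + (~~ b)%:Z + 2).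
Proof.
have := length_block_swap n_gt3 w c; have := (proj2 mw) _ paired_swap; rewrite -/u.
move=> le1 le2 lt_b.
have [//|] := ltP; rewrite le_eqVlt => /orP[/eqP/affine_perm_inj|lt_nb]; first by lia.
have [lt1 lt2] : u (c + 2) < u c /\ u (c + 3) < u (c + 1).
  have E : c + 1 + 2 = c + 3 by lia.
  by case: b lt_b lt_nb => /=; rewrite !addr0 E.
move: le2; rewrite (lt_trans lt1 asc0) lt1 lt2.
by case: ifP => _; lia.
Qed.

(** For nested blocks exactly two of the four cross pairs are inversions, so the length bound for
    the swap is the length of [w] itself. *)
Lemma minimal_paired_swap (b : bool) : u (c + b%:Z + 2) < u (c + b%:Z) ->
  minimal_paired e ((block_swap n c)^-1 * w)%g.
Proof.
move=> lt_b; have lt_nb := minimal_paired_nested lt_b.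
split=> // v zv; apply: leq_trans ((proj2 mw) _ zv).
have := length_block_swap n_gt3 w c; rewrite -/u.
have E : c + 1 + 2 = c + 3 by lia.
case: b lt_b lt_nb => /=; rewrite !addr0 E => lt1 lt2.
  have -> : u (c + 2) < u (c + 1) by apply: lt_trans lt1.
  have -> : (u (c + 2) < u c) = false by apply/negbTE; rewrite -leNgt ltW.
  have -> : (u (c + 3) < u c) = false by apply/negbTE; rewrite -leNgt ltW // (lt_trans lt2).
  by rewrite lt1; lia.
have -> : u (c + 2) < u (c + 1) by apply: lt_trans asc0.
have -> : (u (c + 3) < u (c + 1)) = false by apply/negbTE; rewrite -leNgt ltW.
have -> : (u (c + 3) < u c) = false by apply/negbTE; rewrite -leNgt ltW // (lt_trans asc0).
by rewrite lt1; lia.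
Qed.

Lemma energy_minimal_swap (b : bool) :
  energy n (key b) ((block_swap n c)^-1 * w)^-1%g =
  energy n (key b) u + 8 * (u (c + b%:Z + 2) - u (c + b%:Z)).
Proof.
have [k0 k1] := key_paired b t mw; have [k2 k3] := key_paired b (t + 1) mw.
have E1 : e + 2 + 2 * t = c + 1 by lia.
have E2 : e + 1 + 2 * (t + 1) = c + 2 by lia.
have E3 : e + 2 + 2 * (t + 1) = c + 3 by lia.
have F0 : e + 1 + b%:Z + 2 * t = c + b%:Z by lia.
have F2 : e + 1 + b%:Z + 2 * (t + 1) = c + b%:Z + 2 by lia.
rewrite E1 F0 in k1; rewrite E2 F2 in k2; rewrite E3 F2 in k3; rewrite F0 -/c in k0.
rewrite invgM invgK energy_block_swap //; first by rewrite -/u k2 k0.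
- exact: key_equivariant.
- by rewrite k1 k0.
- by rewrite k3 k2.
Qed.

Lemma prec0_swap (b : bool) : u (c + b%:Z + 2) < u (c + b%:Z) ->
  if b then prec0 w ((block_swap n c)^-1 * w)%g
  else prec0 ((block_swap n c)^-1 * w)%g w.
Proof.
move=> lt_b; have lt_nb := minimal_paired_nested lt_b.
have E : c + 1 + 2 = c + 3 by lia.
have [E1 E2 E3 E4] : [/\ c - 1 + 1 = c, c - 1 + 2 = c + 1, c - 1 + 3 = c + 2
  & c - 1 + 4 = c + 3] by split; lia.
have B r : 0 <= r < n%:Z -> ((block_swap n c)^-1 * w)^-1%g (c + r) =
    u (c + (if r < 2 then r + 2 else if r < 4 then r - 2 else r)).
  by move=> rn; rewrite invgM invgK (affine_mulE u) block_swap_near.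
have B0 : ((block_swap n c)^-1 * w)^-1%g c = u (c + 2).
  by have := B 0; rewrite addr0 => -> //; lia.
have [B1 B2 B3] : [/\ ((block_swap n c)^-1 * w)^-1%g (c + 1) = u (c + 3),
   ((block_swap n c)^-1 * w)^-1%g (c + 2) = u c &
   ((block_swap n c)^-1 * w)^-1%g (c + 3) = u (c + 1)].
  by rewrite !B /= ?addr0; try lia; split.
have Bk k : c - 1 + 5 <= k <= c - 1 + n%:Z -> ((block_swap n c)^-1 * w)^-1%g k = u k.
  by move=> kn; rewrite invgM invgK (affine_mulE u) block_swap_fix //; lia.
case: b lt_b lt_nb; rewrite !addr0 /= E => lt1 lt2.
  (* The windows in [prec0] start at [m + 1], hence [m = c - 1]. *)
  exists (c - 1), (u c), (u (c + 2)), (u (c + 3)), (u (c + 1)).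
  by rewrite !E1 !E2 !E3 !E4 B0 B1 B2 B3; split=> // k /Bk.
exists (c - 1), (u (c + 2)), (u c), (u (c + 1)), (u (c + 3)).
by rewrite !E1 !E2 !E3 !E4 B0 B1 B2 B3; split.
Qed.

End Nested.

(** A step of the order starting at a minimal element must be a swap of two nested blocks, so it
    stays among the minimal elements; the pattern of the step makes the energy of the smaller
    elements grow. *)
Lemma prec0_minimal e w v : minimal_paired e w -> prec0 w v ->
  minimal_paired e v /\ energy n (key false) w^-1%g < energy n (key false) v^-1%g.
Proof.
move=> mw [m [a [b [c [d [[ab bc cd] [wa wd wb wc] [vb vc va vd] wv]]]]]].
have n_gt3 : (3 < n)%N.
  (* For [n = 2] the four positions overlap modulo the period: [c = d + 2] would contradict
     [c < d]. *)
  rewrite ltnNge; apply/negP => n3; have n2 : n%:Z = 2 by lia.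
  have := affine_perm_equi w^-1%g (m + 1); have := affine_perm_equi w^-1%g (m + 2).
  have -> : m + 1 + n%:Z = m + 3 by lia.
  have -> : m + 2 + n%:Z = m + 4 by lia.
  by rewrite wa wb wc wd; lia.
(* If [m + 1] ended a block, then [m + 2, m + 3] would be a block carrying [d, b] with [b < d],
   which is not increasing. *)
have [t [mE|mE]] := parity_cases e (m + 1); last first.
  have := minimal_paired_ascent (t + 1) mw.
  have -> : e + 1 + 2 * (t + 1) = m + 2 by lia.
  have -> : e + 2 + 2 * (t + 1) = m + 3 by lia.
  by rewrite wb wd; lia.
have vE : v = ((block_swap n (e + 1 + 2 * t))^-1 * w)%g.
  apply: invg_inj; rewrite invgM invgK; apply: affine_perm_ext => x.
  have [r [q [r0 rn ->]]] := residue_decomp n_ge2 (e + 1 + 2 * t) x.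
  rewrite affine_permMn (affine_mulE w^-1%g) block_swapE //; last by lia.
  rewrite affine_permMn; congr (_ + _); rewrite -mE.
  have [-> |] := eqVneq r 0.
    by rewrite addr0 vb -wb; congr (w^-1%g _); rewrite /=; lia.
  have [-> _|] := eqVneq r 1.
    by rewrite -(addrA m 1) vc -wc; congr (w^-1%g _); rewrite /=; lia.
  have [-> _ _|] := eqVneq r 2.
    by rewrite -(addrA m 1) va -wa; congr (w^-1%g _); rewrite /=; lia.
  have [-> _ _ _|] := eqVneq r 3.
    by rewrite -(addrA m 1) vd -wd; congr (w^-1%g _); rewrite /=; lia.
  move=> *; have -> : (r < 2) = false by lia.
  have -> : (r < 4) = false by lia.
  by apply/esym/wv; lia.
have lt_b : w^-1%g (e + 1 + 2 * t + true%:Z + 2) < w^-1%g (e + 1 + 2 * t + true%:Z).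
  rewrite -mE (_ : m + 1 + true%:Z + 2 = m + 4); last by lia.
  by rewrite (_ : m + 1 + true%:Z = m + 2) ?wc ?wd //; lia.
rewrite vE; split; first exact: minimal_paired_swap lt_b.
rewrite energy_minimal_swap // !addr0 -mE.
have -> : m + 1 + 2 = m + 3 by lia.
by rewrite wa wb; lia.
Qed.

Lemma prec_minimal e w v : minimal_paired e w -> prec n w v ->
  minimal_paired e v /\ energy n (key false) w^-1%g < energy n (key false) v^-1%g.
Proof.
move=> mw p; elim: p mw => {w v} [w v wv mw|w v x _ IHwv _ IHvx mw].
  exact: prec0_minimal.
have [mv ltv] := IHwv mw; have [mx ltx] := IHvx mv.
by split=> //; apply: lt_trans ltx.
Qed.

Definition key_sorted (b : bool) e w :=
  forall t, w^-1%g (e + 1 + b%:Z + 2 * t) < w^-1%g (e + 1 + b%:Z + 2 * (t + 1)).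

Lemma key_sorting (b : bool) e w : minimal_paired e w ->
  exists w', [/\ minimal_paired e w', key_sorted b e w' &
    w' = w \/ if b then prec n w w' else prec n w' w].
Proof.
have [k] := ubnP `|energy n (key b) w^-1%g|%N; elim: k w => // k IH w ek mw.
have [sw|] := pselect (key_sorted b e w); first by exists w; split=> //; left.
move/existsNP => [t /negP]; rewrite -leNgt le_eqVlt => /orP[/eqP/affine_perm_inj|lt_t].
  by lia.
(* For [n = 2] successive keys differ by a full period, so they are already sorted. *)
have [n3|n_gt3] := leqP n 3.
  move: lt_t; rewrite (_ : e + 1 + b%:Z + 2 * (t + 1) = e + 1 + b%:Z + 2 * t + n%:Z); last by lia.
  by rewrite affine_perm_equi; lia.
set c := e + 1 + 2 * t.
have lt_b : w^-1%g (c + b%:Z + 2) < w^-1%g (c + b%:Z).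
  rewrite (_ : c + b%:Z + 2 = e + 1 + b%:Z + 2 * (t + 1)); last by lia.
  by rewrite (_ : c + b%:Z = e + 1 + b%:Z + 2 * t) //; lia.
have E := energy_minimal_swap n_gt3 t mw b.
have energy_ge0 (v : affine_perm n) : 0 <= energy n (key b) v.
  by apply: sumr_ge0 => i _; apply: sqr_ge0.
have lt_e : (`|energy n (key b) ((block_swap n c)^-1 * w)^-1%g| < k)%N.
  have := energy_ge0 ((block_swap n c)^-1 * w)^-1%g; have := energy_ge0 w^-1%g.
  by rewrite -/c in E; lia.
have [w' [mw' sw' ww']] := IH _ lt_e (minimal_paired_swap n_gt3 mw lt_b).
exists w'; split=> //; right; have := prec0_swap n_gt3 mw lt_b.
case: b ww' {IH ek lt_t lt_b E energy_ge0 lt_e sw'} => ww' p0.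
  by case: ww' => [->|p]; [apply: t_step|apply: t_trans p; apply: t_step].
by case: ww' => [->|p]; [apply: t_step|apply: t_trans p _; apply: t_step].
Qed.

End MinimalPaired.

(** * Lists formed by interleaving two maps *)

Section FlattenPairs.
Variables (T : eqType) (x0 : T) (F G : T -> T).
Implicit Type s : seq T.
Let pairs s := flatten [seq [:: F x; G x] | x <- s].

Lemma size_flatten_pairs s : size (pairs s) = (size s).*2.
Proof. by rewrite /pairs; elim: s => //= x s ->. Qed.

Lemma nth_flatten_pairs s k : (k < size s)%N ->
  nth x0 (pairs s) k.*2 = F (nth x0 s k) /\
  nth x0 (pairs s) k.*2.+1 = G (nth x0 s k).
Proof. by rewrite /pairs; elim: s k => // x s IH [|k] //=; apply: IH. Qed.

Lemma perm_flatten_pairs s : perm_eq (pairs s) (map F s ++ map G s).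
Proof.
rewrite /pairs; elim: s => //= x s IH.
by rewrite perm_cons perm_sym perm_catC /= perm_cons perm_catC perm_sym.
Qed.

End FlattenPairs.

(** * Existence of a pairing, and the windows of the sorted elements *)

Section Windows.
Variables (n : nat) (n_ge2 : (1 < n)%N) (n_even : ~~ odd n).
Variables (z : affine_perm n) (z_fpf : fpf_involutions n z).
Implicit Types (u v w : affine_perm n) (e t x : int).

Let n_gt0 : (0 < n)%N := ltnW n_ge2.

Let nE : n = (n./2).*2.
Proof. by have := odd_double_half n; rewrite (negPf n_even). Qed.

Let zK : involutive z. Proof. by move=> x; case: (z_fpf x). Qed.

(** The sign [g] of [z x - x] is [n]-periodic and is negated by composition with [z]. Its sum over a
    period therefore vanishes, so there are as many ascents as descents. *)
Lemma size_ascents : (size (ascents z)).*2 = n.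
Proof.
pose s : seq int := [seq i%:Z | i <- iota 1 n].
pose g x : int := (x < z x)%R%:Z - (z x < x)%R%:Z.
have zn x : z (x + n%:Z) = z x + n%:Z by apply: affine_perm_equi.
have count_sum (p : pred int) (r : seq nat) :
    \sum_(i <- r) (p i%:Z : nat)%:Z = (count p [seq i%:Z | i <- r])%:Z.
  by elim: r => [|i r IH]; rewrite ?big_nil // big_cons IH /= PoszD.
have pg x : g (x + n%:Z) = g x by rewrite /g zn !ltrD2r.
have := sum_periodic n_gt0 pg (@affine_perm_equi _ z) (@affine_perm_inj _ z).
rewrite (eq_bigr (fun i : nat => - g i%:Z)) => [|i _]; last first.
  by rewrite /g zK opprB.
rewrite sumrN /index_iota subSS subn0 sumrB.
rewrite (count_sum (fun x => x < z x)) (count_sum (fun x => z x < x)) -/s.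
have := count_predC (fun x : int => x < z x) s.
rewrite size_map size_iota (@eq_count _ (predC _) (fun x => z x < x)) => [|x].
  rewrite size_filter -/s; set A := count _ s; set D := count (fun x => z x < x) s.
  by move: A D; clear => A D; lia.
by rewrite /= -leNgt le_eqVlt; case: eqP => // /(proj2 (z_fpf x)).
Qed.

Lemma interval_modn_inj x y : 0 < x <= n%:Z -> 0 < y <= n%:Z ->
  (x %% n)%Z = (y %% n)%Z -> x = y.
Proof.
move=> xn yn /(modz_diff n_gt0)[q xy].
have [q0|[q1|q1]] : q = 0 \/ 1 <= q \/ q <= -1 by lia.
- by rewrite xy q0; lia.
- by nia.
- by nia.
Qed.

Lemma mem_ascents x : (x \in ascents z) = (0 < x <= n%:Z) && (x < z x).
Proof.
rewrite mem_filter andbC; congr (_ && _); apply/mapP/idP => [[i]|xn].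
  by rewrite mem_iota => /andP[i1 i2] ->; lia.
by exists `|x|%N; rewrite ?mem_iota; lia.
Qed.

Lemma mem_descents x : (x \in descents z) = (0 < x <= n%:Z) && (z x < x).
Proof.
rewrite mem_filter andbC; congr (_ && _); apply/mapP/idP => [[i]|xn].
  by rewrite mem_iota => /andP[i1 i2] ->; lia.
by exists `|x|%N; rewrite ?mem_iota; lia.
Qed.

Let zMn x q : z (x + q * n%:Z) = z x + q * n%:Z.
Proof. exact: affine_permMn. Qed.

Lemma uniq_ascent_residues :
  uniq [seq (x %% n)%Z | x <- flatten [seq [:: x; z x] | x <- ascents z]].
Proof.
rewrite (perm_uniq (perm_map _ (perm_flatten_pairs id z _))) map_cat cat_uniq -!map_comp.
have us : uniq (ascents z).
  by rewrite filter_uniq // map_inj_uniq ?iota_uniq // => i j [].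
apply/and3P; split.
- rewrite map_inj_in_uniq // => x y; rewrite !mem_ascents => /andP[xn _] /andP[yn _].
  exact: interval_modn_inj.
(* If [z y = x + q n], then [y = z x + q n], and the ascents at [y] and at [x] contradict each
   other. *)
- apply/hasPn => _ /mapP[y ys ->]; apply/mapP => -[x xs /= /(modz_diff n_gt0)[q zy]].
  have := congr1 z zy; rewrite zK zMn.
  by move: xs ys; rewrite !mem_ascents; lia.
- rewrite map_inj_in_uniq // => x y; rewrite !mem_ascents => /andP[xn _] /andP[yn _] /=.
  move/(modz_diff n_gt0) => [q]; rewrite -zMn => /affine_perm_inj xy.
  by apply: interval_modn_inj => //; rewrite xy addrC modzMDl.
Qed.

(** The window listing the cycles of [z] by ascents works. The base [m] of that window is not
    explicit; its parity decides which offset, and so which base involution, occurs. *)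
Lemma paired_ex : exists2 e : nat, (e < 2)%N & exists w, paired z e%:Z w^-1%g.
Proof.
set c := flatten [seq [:: x; z x] | x <- ascents z].
have sc : size c = n by rewrite (size_flatten_pairs id) size_ascents.
have [m um] := windowP n_gt0 sc uniq_ascent_residues.
have [e [e2 [t mE]]] : exists e : nat, (e < 2)%N /\ exists t, m = e%:Z + 2 * t.
  have [t [->|->]] := parity_cases 0 m.
    by exists 1%N; split=> //; exists t; lia.
  by exists 0%N; split=> //; exists (t + 1); lia.
exists e => //; exists (window n c)^-1%g => t'; rewrite invgK.
have l0 : (0 < n./2)%N by lia.
have lZ : (n./2)%:Z != 0 by lia.
have := divz_eq (t' - t) (n./2)%:Z; have := modz_ge0 (t' - t) lZ.
have := ltz_pmod (t' - t) (l0 : 0 < (n./2)%:Z).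
move: (_ %% _)%Z (_ %/ _)%Z => r q; case: r => // j jl _ tE.
have qn : 2 * (q * (n./2)%:Z) = q * n%:Z.
  by rewrite [in RHS]nE -mul2n PoszM; ring.
have -> : e%:Z + 1 + 2 * t' = m + j.*2.+1%:Z + q * n%:Z by lia.
have -> : e%:Z + 2 + 2 * t' = m + j.*2.+2%:Z + q * n%:Z by lia.
have js : (j < size (ascents z))%N by have := size_ascents; lia.
have [c1 c2] := nth_flatten_pairs 0 id z js.
by rewrite !affine_permMn !um ?c1 ?c2 //; lia.
Qed.

Definition alpha (b : bool) := if b then alpha_max z else alpha_min z.

(** The keys [f t] of the blocks increase strictly and run through all ascents (or descents) of [z]
    in every period. The [n/2] keys starting at the first positive one are thus the sorted list [s],
    which determines a window of [w^-1]. *)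
Lemma key_sorted_alpha (b : bool) e w :
  minimal_paired z e w -> key_sorted b e w -> w = alpha b.
Proof.
move=> mw sw; apply: invg_inj.
have [u uE] : exists u, w^-1%g = u by exists w^-1%g.
rewrite /key_sorted uE in sw; rewrite uE.
pose f t := u (e + 1 + b%:Z + 2 * t).
pose K x := if b then z x < x else x < z x.
pose lo x := if b then z x else x.
pose hi x := if b then x else z x.
pose s := if b then descents z else ascents z.
have sE x : (x \in s) = (0 < x <= n%:Z) && K x.
  by rewrite /s /K; case: (b); rewrite ?mem_descents ?mem_ascents.
have -> : (alpha b)^-1%g = window n (flatten [seq [:: lo x; hi x] | x <- s]).
  by rewrite /alpha /s /lo /hi; case: (b); rewrite invgK.
have uz t : [/\ lo (f t) = u (e + 1 + 2 * t), hi (f t) = u (e + 2 + 2 * t) & K (f t)].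
  have := minimal_paired_ascent n_ge2 n_even zK t mw; have := (proj1 mw) t.
  rewrite uE => zu asc.
  rewrite /lo /hi /K /f; case: (b) => /=.
    have -> : e + 1 + 1%:Z + 2 * t = e + 2 + 2 * t by ring.
    by rewrite -zu zK; split=> //; rewrite zu.
  by rewrite addr0 zu.
have fS t : f t < f (t + 1) := sw t.
have fMn t q : f (t + q * (n./2)%:Z) = f t + q * n%:Z.
  rewrite /f -affine_permMn; congr (u _).
  by rewrite {2}nE -mul2n PoszM; ring.
clearbody f.
have fD t (k : nat) : f t + k%:Z <= f (t + k%:Z).
  elim: k => [|k IH]; first by rewrite !addr0.
  have -> : t + k.+1%:Z = t + k%:Z + 1 by lia.
  by have := fS (t + k%:Z); lia.
have fmono t t' : t < t' -> f t < f t'.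
  move=> lt_t; have := fD t `|t' - t|%N.
  have -> : t + `|t' - t|%N%:Z = t' by lia.
  by lia.
have [t0 [f0 f1]] : exists t, f (t - 1) <= 0 /\ 0 < f t.
  (* Going back by [|f 0|] periods makes the key nonpositive; from there [f] grows by at least one
     per block, so a least natural number of blocks reaches a positive key. *)
  pose T := - (`|f 0|%:Z) * (n./2)%:Z.
  have fT : f T <= 0.
    by have := fMn 0 (- `|f 0|%:Z); rewrite add0r -/T; nia.
  have exk : exists k : nat, 0 < f (T + k%:Z).
    exists `|f T|.+1; apply: lt_le_trans (fD _ _).
    by move: (f T) => y; lia.
  have [k fk kmin] := ex_minnP exk; exists (T + k%:Z); split=> //.
  case: k fk kmin => [|k] fk kmin; first by move: fk; rewrite addr0; lia.
  have -> : T + k.+1%:Z - 1 = T + k%:Z by lia.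
  by rewrite leNgt; apply/negP => /kmin; rewrite ltnn.
have sf : s = [seq f (t0 + i%:Z) | i <- iota 0 n./2].
  (* Two strictly increasing lists with the same members are equal. *)
  apply: (irr_sorted_eq (@lt_trans _ int) (@ltxx _ int)).
  - have us p : sorted <%R [seq x <- [seq i%:Z | i <- iota 1 n] | p x].
      apply: (sorted_filter (@lt_trans _ int)).
      by apply: (homo_sorted (e := ltn)); rewrite ?iota_ltn_sorted.
    by rewrite /s; case: (b); apply: us.
  - by apply: (homo_sorted (e := ltn)) (iota_ltn_sorted _ _) => i j ij; apply: fmono; lia.
  move=> x; rewrite sE; apply/andP/mapP => [[xn Kx]|[i]].
    have [t xE] : exists t, x = f t.
      (* The integer [x] sits at position [w x]; were this not the key position of its block, [K x]
         would fail. *)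
      have [t tE] := parity_cases e (w x); have xE : x = u (w x) by rewrite -uE affine_permK.
      have [z1 z2 z3] := uz t; exists t.
      move: xE tE z1 z2 z3 Kx (zK (f t)); rewrite /K /lo /hi; case: (b) => xE [tE|tE];
        rewrite -tE -xE => z1 z2 z3 Kx zft.
      - by move: Kx; rewrite -z1 zft; lia.
      - by [].
      - by [].
      - by move: Kx; rewrite -z2 zft; lia.
    have t0t : t0 <= t.
      rewrite leNgt; apply/negP => lt_t.
      have : f t <= f (t0 - 1).
        have [->//|ne] := eqVneq t (t0 - 1); apply/ltW/fmono; lia.
      lia.
    have tl : t < t0 + (n./2)%:Z.
      rewrite ltNge; apply/negP => le_t; have fl := fMn t0 1; rewrite !mul1r in fl.
      have : f (t0 + (n./2)%:Z) <= f t.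
        by move: le_t; rewrite le_eqVlt => /orP[/eqP->//|/fmono/ltW].
      lia.
    exists `|t - t0|%N; first by rewrite mem_iota; lia.
    by rewrite xE; congr f; lia.
  rewrite mem_iota => il ->; have [_ _ Kx] := uz (t0 + i%:Z); split=> //.
  (* A period after the nonpositive key at [t0 - 1] the key is at most [n], which bounds the last
     listed key. *)
  have fl := fMn (t0 - 1) 1; rewrite !mul1r in fl.
  apply/andP; split.
    by have := fD t0 i; lia.
  have : f (t0 + i%:Z) <= f (t0 - 1 + (n./2)%:Z).
    have [e1|ne] := eqVneq (t0 + i%:Z) (t0 - 1 + (n./2)%:Z); first by rewrite e1.
    by apply/ltW/fmono; lia.
  lia.
have ss : size s = n./2 by rewrite sf size_map size_iota.
have sc : size (flatten [seq [:: lo x; hi x] | x <- s]) = n.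
  by rewrite size_flatten_pairs ss -nE.
have um : forall k, (k < n)%N ->
    u (e + 2 * t0 + k.+1%:Z) = (flatten [seq [:: lo x; hi x] | x <- s])`_k.
  move=> k kn; have [ls hs] := @nth_flatten_pairs _ 0 lo hi s k./2 ltac:(rewrite ss; lia).
  have [z1 z2 _] := uz (t0 + k./2%:Z).
  have ksE : s`_k./2 = f (t0 + k./2%:Z).
    by rewrite sf (nth_map 0%N) ?size_iota ?nth_iota ?add0n //; lia.
  have := odd_double_half k; case: (odd k) => kE.
    rewrite -[in RHS]kE add1n hs ksE z2; congr (u _); lia.
  rewrite -[in RHS]kE add0n ls ksE z1; congr (u _); lia.
have uw : exists m : int, forall k, (k < n)%N ->
    u (m + k.+1%:Z) = (flatten [seq [:: lo x; hi x] | x <- s])`_k.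
  by exists (e + 2 * t0).
apply: (window_unique n_gt0 uw).
(* Here [u] itself shows that the choice defining [window] is not its default value. *)
exact: (@xgetPex _ 1%g [set w : affine_perm n | exists m : int,
  forall k, (k < n)%N -> w (m + k.+1%:Z) = _`_k] (ex_intro _ u uw)).
Qed.

End Windows.

Theorem theorem3p9 (n : nat) (z : affine_perm n)
    (n_ge2 : (2 <= n)%N) (n_even : ~~ odd n) (z_fpf : fpf_involutions n z) :
  [/\ StrictOrder (restrict_rel (fpf_atoms z) (prec n)),
      minimum_elements (fpf_atoms z) (prec n) = [set alpha_min z] &
      maximum_elements (fpf_atoms z) (prec n) = [set alpha_max z]].
Proof.
have zK : involutive z by move=> x; case: (z_fpf x).
have atomP w := fpf_atomsP n_ge2 n_even zK w.
have irr w : fpf_atoms z w -> ~ prec n w w.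
  move=> /atomP[e _ mw] /(prec_minimal n_ge2 n_even zK mw)[_].
  by rewrite ltxx.
(* Sorting may start at any atom, of either offset, and ends at the same [alpha z b]. *)
have extremal (b : bool) w : fpf_atoms z w -> fpf_atoms z (alpha z b) /\
    (alpha z b = w \/ if b then prec n w (alpha z b) else prec n (alpha z b) w).
  move=> /atomP[e e2 mw].
  have [w' [mw' sw' ww']] := key_sorting n_ge2 n_even zK b mw.
  rewrite -(key_sorted_alpha n_ge2 n_even z_fpf mw' sw').
  by split=> //; apply/atomP; exists e.
have [w0 aw0] : exists w, fpf_atoms z w.
  have [e e2 [w pw]] := paired_ex n_ge2 n_even z_fpf.
  by have [v mv] := minimal_paired_ex pw; exists v; apply/atomP; exists e.
split.
- split; first by move=> [w aw]; apply: irr.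
  by move=> x y t; apply: t_trans.
- have [amin _] := extremal false _ aw0.
  rewrite eqEsubset; split=> [w [aw wmin]|_ ->]; last first.
    by split=> // w /(extremal false)[_ []]; [left|right].
  (* A second minimum would lie below and above [alpha_min z], hence strictly below itself. *)
  have [//|wa] := wmin _ amin; have [_ [//|aw']] := extremal false _ aw.
  by case: (irr w aw); apply: t_trans aw'.
- have [amax _] := extremal true _ aw0.
  rewrite eqEsubset; split=> [w [aw wmax]|_ ->]; last first.
    by split=> // w /(extremal true)[_ [<-|]]; [left|right].
  have [//|wa] := wmax _ amax; have [_ [//|aw']] := extremal true _ aw.
  by case: (irr w aw); apply: t_trans wa.
Qed.
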